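(* Consider the semi-random corruption model with corruption probability $p$. Assume that $r_{\bar x}, r_{\bar y}, r_{\bar z}$ are positive constants (independent of $n,m,l$) and $$\lim_{n,m,l\to\infty}\frac{n+m+l}{\min\{nm,nl,ml\}}=0.$$ If $p$ is a constant satisfying $p<1/2$, then Problem (P) recovers the ground truth with high probability.
   Context: Write $[n]=\{1,\dots,n\}$. For vectors $x\in\mathbb R^n,y\in\mathbb R^m,z\in\mathbb R^l$, $x\otimes y\otimes z$ is the $n\times m\times l$ tensor with $(i,j,k)$ entry $x_iy_jz_k$; $\|\cdot\|$ is the Frobenius norm. Fully-random corruption model: fix $\bar x\in\{0,1\}^n$, $\bar y\in\{0,1\}^m$, $\bar z\in\{0,1\}^l$; the ground truth is $\bar{\mathcal W}=\bar x\otimes\bar y\otimes\bar z$. Given $p\in[0,1]$, the random noisy binary tensor $\mathcal G=(g_{ijk})$ is obtained by corrupting each entry independently: $g_{ijk}=1-\bar x_i\bar y_j\bar z_k$ with probability $p$ and $g_{ijk}=\bar x_i\bar y_j\bar z_k$ with probability $1-p$. Semi-random corruption model: first $\mathcal G$ is generated by the fully-random model; then an adversary modifies $\mathcal G$ by an arbitrary sequence of monotone transformations, i.e. the adversary may choose any set of corrupted entries (entries where $\mathcal G$ differs from $\bar{\mathcal W}$) and revert them to their values in $\bar{\mathcal W}$. The resulting tensor is the input of the optimization problem. $r_{\bar x}$ (resp. $r_{\bar y}$, $r_{\bar z}$) is the ratio of the number of ones in $\bar x$ (resp. $\bar y$, $\bar z$) to its number of entries. Problem (P), with input a binary tensor $\mathcal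 G$: minimize $\|\mathcal G-x\otimes y\otimes z\|^2$ over $x\in\{0,1\}^n$, $y\in\{0,1\}^m$, $z\in\{0,1\}^l$. Problem (P) recovers the ground truth if it has a unique optimal solution and this solution is $(\bar x,\bar y,\bar z)$. ''With high probability'' means with probability tending to $1$ as $n,m,l\to\infty$ (along a family of instances whose three dimensions all go to infinity). *)

(* Defs.v *)
From HB Require Import structures.
From mathcomp Require Import all_boot all_order all_algebra.
From mathcomp Require Import all_classical all_reals all_analysis.
Set Implicit Arguments.
Unset Strict Implicit.
Unset Printing Implicit Defensive.
Import Order.TTheory GRing.Theory Num.Theory.
Import numFieldNormedType.Exports.
Local Open Scope classical_set_scope.
Local Open Scope ring_scope.

(* The index set [n] is 'I_n, and an entry (i, j, k) of a third-order tensor is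
   indexed by ((i, j), k). *)
Definition idx3 (n m l : nat) := ('I_n * 'I_m * 'I_l)%type.

Definition tensor (R : realType) (n m l : nat) := {ffun idx3 n m l -> R}.

Definition outer (R : realType) (n m l : nat)
    (x : 'rV[R]_n) (y : 'rV[R]_m) (z : 'rV[R]_l) : tensor R n m l :=
  [ffun t => x 0 t.1.1 * y 0 t.1.2 * z 0 t.2].

Definition frobenius (R : realType) (n m l : nat) (A : tensor R n m l) : R :=
  Num.sqrt (\sum_t A t ^+ 2).

(* Elements of {0,1}^n and of {0,1}^(n x m x l) are boolean functions; [rvec]
   and [rtensor] view them inside R^n and R^(n x m x l). *)
Definition bvec (n : nat) := {ffun 'I_n -> bool}.
Definition btensor (n m l : nat) := {ffun idx3 n m l -> bool}.

Definition rvec (R : realType) (n : nat) (x : bvec n) : 'rV[R]_n :=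
  \row_i (x i)%:R.

Definition rtensor (R : realType) (n m l : nat) (G : btensor n m l) :
    tensor R n m l :=
  [ffun t => (G t)%:R].

(* On {0,1} the product is the conjunction; see [rtensor_truth]. *)
Definition truth (n m l : nat) (x : bvec n) (y : bvec m) (z : bvec l) :
    btensor n m l :=
  [ffun t => [&& x t.1.1, y t.1.2 & z t.2]].

Lemma rtensor_truth (R : realType) (n m l : nat)
    (x : bvec n) (y : bvec m) (z : bvec l) :
  rtensor R (truth x y z) = outer (rvec R x) (rvec R y) (rvec R z).
Proof.
by apply/ffunP => t; rewrite !ffunE !mxE -!natrM !mulnb andbA.
Qed.

Definition ones_ratio (R : realType) (n : nat) (x : bvec n) : R :=
  #|[set i | x i]%SET|%:R / n%:R.

Definition objective (R : realType) (n m l : nat) (G : btensor n m l)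
    (s : bvec n * bvec m * bvec l) : R :=
  frobenius (rtensor R G
             - outer (rvec R s.1.1) (rvec R s.1.2) (rvec R s.2)) ^+ 2.

Definition optimal (R : realType) (n m l : nat) (G : btensor n m l)
    (s : bvec n * bvec m * bvec l) : Prop :=
  forall s', objective R G s <= objective R G s'.

Definition recovers (R : realType) (n m l : nat)
    (x : bvec n) (y : bvec m) (z : bvec l) (G : btensor n m l) : Prop :=
  forall s, optimal R G s <-> s = (x, y, z).

(* Mutual independence of a finite family of random variables. *)
Definition mutually_independent (R : realType) (d : measure_display)
    (T : measurableType d) (P : probability T R) (I : finType)
    (d' : measure_display) (T' : measurableType d') (X : I -> T -> T') : Prop :=
  forall (J : {set I}) (B : I -> set T'), (forall i, measurable (B i)) ->
    P (\bigcap_(i in [set` J]) (X i @^-1` B i)) =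
    (\prod_(i in J) P (X i @^-1` B i))%E.

Definition random_btensor (d : measure_display) (T : measurableType d)
    (n m l : nat) (G : T -> btensor n m l) : Prop :=
  forall t, measurable_fun [set: T] (fun w => G w t).

Definition fully_random (R : realType) (d : measure_display)
    (T : measurableType d) (P : probability T R) (n m l : nat) (p : R)
    (x : bvec n) (y : bvec m) (z : bvec l) (G : T -> btensor n m l) : Prop :=
  [/\ random_btensor G,
      mutually_independent P (fun t w => G w t),
      forall t, P [set w | G w t = ~~ truth x y z t] = p%:E
    & forall t, P [set w | G w t = truth x y z t] = (1 - p)%:E].

Definition corrupted (n m l : nat) (W G : btensor n m l) :
    {set idx3 n m l} :=
  [set t | G t != W t]%SET.

Definition revert (n m l : nat) (W G : btensor n m l)
    (S : {set idx3 n m l}) : btensor n m l :=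
  [ffun t => if t \in S then W t else G t].

(* A sequence of reversions amounts to a single one, on the union of the
   chosen sets of corrupted entries. *)
Definition monotone_transformation (n m l : nat) (W G G' : btensor n m l) :
    Prop :=
  exists2 S : {set idx3 n m l}, S \subset corrupted W G & G' = revert W G S.

(* The set of reverted entries may depend on the outcome [w], hence on the
   whole tensor [G w] and on additional randomness; the only constraint on the
   adversary is that the resulting tensor is a random variable. *)
Definition semi_random (R : realType) (d : measure_display)
    (T : measurableType d) (P : probability T R) (n m l : nat) (p : R)
    (x : bvec n) (y : bvec m) (z : bvec l) (G' : T -> btensor n m l) : Prop :=
  random_btensor G' /\
  exists2 G : T -> btensor n m l, fully_random P p x y z G &
    forall w, monotone_transformation (truth x y z) (G w) (G' w).

(* Main.v *)
Require Import Defs.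
From HB Require Import structures.
From mathcomp Require Import all_boot all_order all_algebra.
From mathcomp Require Import all_classical all_reals all_analysis.
From mathcomp Require Import zify ring lra.
Import Order.TTheory GRing.Theory Num.Theory.
Import numFieldNormedType.Exports.
Local Open Scope classical_set_scope.
Local Open Scope ring_scope.

(** The squared Frobenius distance between binary tensors counts the entries
    where they differ.  Hence replacing the planted solution by a competitor
    [s] changes the objective only on the set [D_s] of entries where the
    rank-one tensors of the two solutions disagree: each uncorrupted entry of
    [D_s] adds one and each corrupted entry removes one.  So the planted
    solution is the unique optimum as soon as, for every competitor, fewer than
    half of the entries of [D_s] are corrupted ([recovers_of_minority]).  A
    monotone adversary only shrinks the set of corrupted entries, so it is
    enough to establish this for the fully-random tensor.

    Two estimates show that no competitor is bad.
    - Geometry: [D_s] contains a copy of a two-dimensional slice of the planted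
      block, the set of entries where the planted tensor is one
      ([card_disagreement]), so its size is at least a constant multiple of
      [min(nm, nl, ml)] ([min_slice_ge]).
    - Probability: for a fixed set [D], a given pattern of corruptions covering
      at least half of [D] has probability at most [sqrt(p(1-p)) ^ |D|] because
      [p <= 1 - p], and there are at most [2 ^ |D|] patterns.  Half of [D] is
      therefore corrupted with probability at most [q ^ |D|], where
      [q = 2 sqrt(p(1-p)) < 1] ([prob_corrupted_majority]).

    There are [2 ^ (n+m+l)] competitors.  Choose [k] with [q ^ k <= 1/4]: by the
    growth assumption [|D_s| >= k (n+m+l)] eventually, so the union bound gives
    a failure probability of at most
    [2 ^ (n+m+l) * 4 ^ -(n+m+l) = 2 ^ -(n+m+l)], which tends to zero. *)

Set Implicit Arguments.
Unset Strict Implicit.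

(** * Deterministic recovery *)

Lemma objective_card (R : realType) (n m l : nat) (g : btensor n m l)
    (s : bvec n * bvec m * bvec l) :
  objective R g s = #|corrupted (truth s.1.1 s.1.2 s.2) g|%:R.
Proof.
rewrite /objective /frobenius -rtensor_truth sqr_sqrtr; last first.
  by apply: sumr_ge0 => t _; exact: sqr_ge0.
rewrite -sum1_card natr_sum [RHS]big_mkcond /=.
apply: eq_bigr => t _; rewrite !ffunE inE !ffunE.
set b := [&& _, _ & _]; case: (g t); case: b => /=;
  by rewrite ?subrr ?subr0 ?sub0r ?sqrrN ?expr1n ?expr0n.
Qed.

(** The tensor [g] differs from [S] exactly on the symmetric difference of
    [corrupted W g] and [corrupted W S], whose cardinal is
    [|A| + |B| - 2 |A :&: B|]. *)
Lemma card_corrupted_xor (n m l : nat) (W S g : btensor n m l) :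
  (#|corrupted S g| + 2 * #|corrupted W g :&: corrupted W S|
   = #|corrupted W g| + #|corrupted W S|)%N.
Proof.
set C := corrupted W g; set D := corrupted W S.
have -> : corrupted S g = ((C :|: D) :\: (C :&: D))%SET.
  apply/setP => t; rewrite !inE.
  by case: (g t); case: (S t); case: (W t).
have h := cardsUI C D.
have h2 := cardsID (C :&: D)%SET (C :|: D)%SET.
have h3 : (C :|: D) :&: (C :&: D) = (C :&: D) :> {set _}.
  by apply/setP => t; rewrite !inE; case: (g t != _); case: (S t != _).
rewrite h3 in h2; lia.
Qed.

(** By [card_corrupted_xor], passing from the planted solution to [s] changes the
    objective by the size of the disagreement set minus twice its corrupted
    part. *)
Lemma recovers_of_minority (R : realType) (n m l : nat)
    (x : bvec n) (y : bvec m) (z : bvec l) (g : btensor n m l) :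
  (forall s, s != (x, y, z) ->
    2 * #|corrupted (truth x y z) g
          :&: corrupted (truth x y z) (truth s.1.1 s.1.2 s.2)|
    < #|corrupted (truth x y z) (truth s.1.1 s.1.2 s.2)|)%N ->
  recovers R x y z g.
Proof.
move=> minority.
have lt_obj s : s != (x, y, z) -> objective R g (x, y, z) < objective R g s.
  move=> /minority minor; rewrite !objective_card ltr_nat /=.
  have E := card_corrupted_xor (truth x y z) (truth s.1.1 s.1.2 s.2) g.
  by move: minor; rewrite -(ltn_add2l #|corrupted (truth x y z) g|) -E ltn_add2r.
move=> s; split=> [opt|-> s'].
  apply/eqP; case: eqVneq => // /lt_obj.
  by rewrite ltNge opt.
by have [->|/lt_obj/ltW//] := eqVneq s' (x, y, z).
Qed.

Lemma corrupted_monotone (n m l : nat) (W g g' : btensor n m l) :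
  monotone_transformation W g g' -> corrupted W g' \subset corrupted W g.
Proof.
case=> S _ ->; apply/fintype.subsetP => t; rewrite !inE ffunE.
by case: ifP; rewrite ?eqxx.
Qed.

Lemma exists_extra_one (n : nat) (x x' : bvec n) :
  (forall i, x i -> x' i) -> x' != x -> exists2 i, x' i & ~~ x i.
Proof.
move=> sub ne; have [i nei] : exists i, x' i != x i.
  apply/existsP; apply: contraNT ne; rewrite negb_exists => /forallP h.
  by apply/eqP/ffunP => i; have := h i; rewrite negbK => /eqP.
by exists i; move: nei (sub i); case: (x' i); case: (x i) => // _ /(_ isT).
Qed.

(** The bound is the smallest two-dimensional slice of the planted block.  If [s]
    misses a one of some planted factor, the whole slice of the block at that
    index is lost.  Otherwise the factors of [s] contain the planted ones, and
    any additional one, say in the first factor at index [i], creates a slice at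
    [i] that contains a copy of the planted slice. *)
Lemma card_disagreement (n m l : nat) (x : bvec n) (y : bvec m) (z : bvec l)
    (s : bvec n * bvec m * bvec l) :
  s != (x, y, z) ->
  (minn (#|[set i | x i]%SET| * #|[set j | y j]%SET|)
     (minn (#|[set i | x i]%SET| * #|[set k | z k]%SET|)
           (#|[set j | y j]%SET| * #|[set k | z k]%SET|))
   <= #|corrupted (truth x y z) (truth s.1.1 s.1.2 s.2)|)%N.
Proof.
set a := #|[set i | x i]%SET|; set b := #|[set j | y j]%SET|.
set c := #|[set k | z k]%SET|; move=> sNe; case: s sNe => [[x' y'] z'] /= sNe.
set D := corrupted _ _; set e := (X in (_ <= X)%N).
have sliceD (A : {set 'I_n}) (B : {set 'I_m}) (C : {set 'I_l}) :
    (forall i j k, i \in A -> j \in B -> k \in C ->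
       [&& x' i, y' j & z' k] != [&& x i, y j & z k]) ->
    (#|A| * #|B| * #|C| <= e)%N.
  move=> ne; rewrite -!cardsX; apply/subset_leq_card/fintype.subsetP.
  move=> [[i j] k]; rewrite !inE /= => /andP[/andP[iA jB] kC].
  by rewrite !ffunE /= ne.
have [/existsP[i /andP[xi x'i]]|] := boolP [exists i, x i && ~~ x' i].
  have := sliceD [set i]%SET [set j | y j]%SET [set k | z k]%SET.
  rewrite cards1 => H; suff: (1 * b * c <= e)%N by lia.
  apply: H => i' j k; rewrite !inE => /eqP-> -> ->.
  by rewrite xi (negbTE x'i).
rewrite negb_exists => /forallP xle.
have [/existsP[j /andP[yj y'j]]|] := boolP [exists j, y j && ~~ y' j].
  have := sliceD [set i | x i]%SET [set j]%SET [set k | z k]%SET.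
  rewrite cards1 => H; suff: (a * 1 * c <= e)%N by lia.
  apply: H => i j' k; rewrite !inE => -> /eqP-> ->.
  by rewrite yj (negbTE y'j) andbF.
rewrite negb_exists => /forallP yle.
have [/existsP[k /andP[zk z'k]]|] := boolP [exists k, z k && ~~ z' k].
  have := sliceD [set i | x i]%SET [set j | y j]%SET [set k]%SET.
  rewrite cards1 => H; suff: (a * b * 1 <= e)%N by lia.
  apply: H => i j k'; rewrite !inE => -> -> /eqP->.
  by rewrite zk (negbTE z'k) !andbF.
rewrite negb_exists => /forallP zle.
have xS i : x i -> x' i by move=> xi; have := xle i; rewrite xi /= negbK.
have yS i : y i -> y' i by move=> yi; have := yle i; rewrite yi /= negbK.
have zS i : z i -> z' i by move=> zi; have := zle i; rewrite zi /= negbK.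
(* The factors of the competitor now contain the planted ones, and one of them
   has an additional one. *)
have [ex|/(exists_extra_one xS)[i x'i xi]] := eqVneq x' x; last first.
  have := sliceD [set i]%SET [set j | y j]%SET [set k | z k]%SET.
  rewrite cards1 => H; suff: (1 * b * c <= e)%N by lia.
  apply: H => i' j k; rewrite !inE => /eqP-> yj zk.
  by rewrite (negbTE xi) x'i yS// zS.
have [ey|/(exists_extra_one yS)[j y'j yj]] := eqVneq y' y; last first.
  have := sliceD [set i | x i]%SET [set j]%SET [set k | z k]%SET.
  rewrite cards1 => H; suff: (a * 1 * c <= e)%N by lia.
  apply: H => i j' k; rewrite !inE => xi /eqP-> zk.
  by rewrite (negbTE yj) y'j xS// zS// andbF.
have [ez|/(exists_extra_one zS)[k z'k zk]] := eqVneq z' z; last first.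
  have := sliceD [set i | x i]%SET [set j | y j]%SET [set k]%SET.
  rewrite cards1 => H; suff: (a * b * 1 <= e)%N by lia.
  apply: H => i j k'; rewrite !inE => xi yj /eqP->.
  by rewrite (negbTE zk) z'k xS// yS// !andbF.
by move: sNe; rewrite ex ey ez eqxx.
Qed.

(** * Probability of a corrupted majority *)

(** The space of binary tensors is finite, so every event expressed through the
    tensor alone is a finite Boolean combination of coordinate events.  All
    measurability conditions below reduce to this one. *)
Lemma measurable_btensor_event (n m l : nat) (d : measure_display)
    (T : measurableType d) (G : T -> btensor n m l) (Q : btensor n m l -> Prop) :
  random_btensor G -> measurable [set w | Q (G w)].
Proof.
move=> mG.
have -> : [set w | Q (G w)] =
    \bigcup_(g in Q) \bigcap_(t in setT) ((fun w => G w t) @^-1` [set g t]).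
  apply/seteqP; split=> w /= => [QG|[g Qg Gw]].
    by exists (G w).
  by have -> : G w = g by apply/ffunP => t; exact: Gw.
apply: fin_bigcup_measurable => [|g _]; first exact: finite_finset.
apply: fin_bigcap_measurable => [|t _]; first exact: finite_finset.
by rewrite -[X in measurable X]setTI; exact: mG.
Qed.

(** The union bound, indexed by a list so as to apply to enumerations of subsets
    and of solutions alike. *)
Lemma probability_fin_union (R : realType) (d : measure_display)
    (T : measurableType d) (P : probability T R) (I : Type) (r : seq I)
    (F : I -> set T) (f : I -> R) :
  (forall i, measurable (F i)) -> (forall i, (P (F i) <= (f i)%:E)%E) ->
  (P (\big[setU/set0]_(i <- r) F i) <= (\sum_(i <- r) f i)%:E)%E.
Proof.
move=> mF le_f; elim: r => [|i r IH]; first by rewrite !big_nil measure0 lexx.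
rewrite !big_cons EFinD.
apply: (le_trans (measureU2 _ _ _)) => //; last exact: (leeD (le_f i) IH).
exact: bigsetU_measurable.
Qed.

(** Prescribing the whole corruption pattern on [D] prescribes the value of every
    entry of [D], so that independence gives a product formula. *)
Lemma prob_corruption_pattern (R : realType) (d : measure_display)
    (T : measurableType d) (P : probability T R) (n m l : nat) (p : R)
    (x : bvec n) (y : bvec m) (z : bvec l) (G : T -> btensor n m l)
    (A D : {set idx3 n m l}) :
  fully_random P p x y z G -> A \subset D ->
  P [set w | corrupted (truth x y z) (G w) :&: D = A :> {set idx3 n m l}]
  = (p ^+ #|A| * (1 - p) ^+ #|D :\: A|)%:E.
Proof.
set W := truth x y z => -[mG indG PGcorr PGok] AD.
pose v t := if t \in A then ~~ W t else W t.
have -> : [set w | corrupted W (G w) :&: D = A :> {set _}] =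
    \bigcap_(t in [set` D]) ((fun w => G w t) @^-1` [set v t]).
  apply/seteqP; split=> w /= => [CDA t /= tD|Gv].
    have : (t \in corrupted W (G w) :&: D) = (t \in A) by rewrite CDA.
    rewrite /v !inE tD andbT => <-.
    by case: (G w t); case: (W t).
  apply/setP => t; rewrite !inE.
  have [tD|tD] := boolP (t \in D); last first.
    by rewrite andbF; apply/esym/negbTE; apply: contra tD; apply/fintype.subsetP.
  by have /= := Gv t tD => ->; rewrite /v; case: (t \in A); case: (W t).
rewrite indG//.
rewrite (eq_bigr (fun t => (if t \in A then p else 1 - p)%:E)); last first.
  by move=> t _; rewrite /v; case: (t \in A); [exact: PGcorr|exact: PGok].
rewrite prodEFin; congr EFin.
rewrite (big_setID A)/=; congr (_ * _).
  rewrite (finset.setIidPr AD) -prodr_const; apply: eq_bigr => t tA.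
  by rewrite tA.
rewrite -prodr_const; apply: eq_bigr => t.
by rewrite inE => /andP[/negbTE->].
Qed.

(** Pair each of the [b] factors [1 - p] with a factor [p]; the [a - b] factors
    [p] that are left are at most [sqrt (p (1 - p))] since [p <= 1 - p]. *)
Lemma pattern_weight_le (R : realType) (p : R) (a b : nat) :
  0 <= p -> p < 1 / 2 -> (b <= a)%N ->
  p ^+ a * (1 - p) ^+ b <= Num.sqrt (p * (1 - p)) ^+ (a + b).
Proof.
move=> p0 p12 ba; set q := Num.sqrt _.
have pp0 : 0 <= p * (1 - p) by apply: mulr_ge0 => //; lra.
have q2 : q ^+ 2 = p * (1 - p) by rewrite sqr_sqrtr.
have p_le_q : p <= q.
  rewrite -(@ler_pXn2r _ 2)// ?nnegrE ?sqrtr_ge0// q2 expr2.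
  by apply: ler_wpM2l => //; lra.
rewrite -{1}(subnK ba) exprD -mulrA -exprMn -q2 -exprM.
have -> : (a + b = a - b + 2 * b)%N by lia.
rewrite [leRHS]exprD; apply: ler_wpM2r; first by rewrite exprn_ge0// sqrtr_ge0.
by rewrite lerXn2r// nnegrE// sqrtr_ge0.
Qed.

(** Summing over the at most [2 ^ |D|] corruption patterns of [D] yields the
    exponential rate of the Chernoff bound at threshold one half, without any
    moment generating function. *)
Lemma prob_corrupted_majority (R : realType) (d : measure_display)
    (T : measurableType d) (P : probability T R) (n m l : nat) (p : R)
    (x : bvec n) (y : bvec m) (z : bvec l) (G : T -> btensor n m l)
    (D : {set idx3 n m l}) :
  0 <= p -> p < 1 / 2 -> fully_random P p x y z G ->
  (P [set w | (#|D| <= 2 * #|corrupted (truth x y z) (G w) :&: D|)%N]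
   <= ((2 * Num.sqrt (p * (1 - p))) ^+ #|D|)%:E)%E.
Proof.
move=> p0 p12 frG; have [mG _ _ _] := frG; set W := truth x y z.
(* The condition on [A] makes [F A] empty unless [A] is a majority pattern, so
   that the bound on the probability of [F A] holds for every [A]. *)
pose F (A : {set idx3 n m l}) : set T := [set w |
  (A \subset D) && (#|D| <= 2 * #|A|)%N /\ corrupted W (G w) :&: D = A :> {set _}].
have mF A : measurable (F A).
  exact: (measurable_btensor_event (fun g =>
    (A \subset D) && (#|D| <= 2 * #|A|)%N /\ corrupted W g :&: D = A :> {set _})).
have -> : [set w | (#|D| <= 2 * #|corrupted W (G w) :&: D|)%N] =
    \big[setU/set0]_(A <- enum (powerset D)) F A.
  rewrite -bigcup_seq; apply/seteqP; split=> w /= => [maj|[A _ [/andP[_ ?] ->]]//].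
  exists (corrupted W (G w) :&: D)%SET.
    by rewrite /= mem_enum powersetE finset.subsetIr.
  by split=> //; rewrite finset.subsetIr maj.
pose q := Num.sqrt (p * (1 - p)).
apply: (le_trans (probability_fin_union (f := fun=> q ^+ #|D|) _ mF _)).
  move=> A; have [/andP[AD maj]|nA] := boolP ((A \subset D) && (#|D| <= 2 * #|A|)%N).
    have -> : F A = [set w | corrupted W (G w) :&: D = A :> {set _}].
      by apply/seteqP; split=> w; [case|split; rewrite ?AD ?maj].
    rewrite (prob_corruption_pattern frG AD) lee_fin.
    have cD : (#|A| + #|D :\: A| = #|D|)%N.
      by rewrite -(cardsID A D) (finset.setIidPr AD).
    rewrite -cD; apply: pattern_weight_le => //; lia.
  have -> : F A = set0 by apply/seteqP; split=> [w [h _]|w []]; rewrite h in nA.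
  by rewrite measure0 lee_fin exprn_ge0// sqrtr_ge0.
rewrite lee_fin big_const_seq count_predT iter_addr_0 -cardE card_powerset.
by rewrite exprMn -natrX mulr_natl.
Qed.

(** * Union bound over the competing solutions *)

(** Strict inequality between the geometric and arithmetic means of [p] and
    [1 - p], which differ when [p < 1/2]. *)
Lemma two_sqrt_lt1 (R : realType) (p : R) :
  p < 1 / 2 -> 2 * Num.sqrt (p * (1 - p)) < 1.
Proof.
move=> p12; have [pp0|pp0] := leP (p * (1 - p)) 0.
  by rewrite ler0_sqrtr// mulr0.
have q0 := sqrtr_ge0 (p * (1 - p)); have := sqr_sqrtr (ltW pp0).
set q := Num.sqrt _ in q0 *; nra.
Qed.

(** The non-asymptotic form of the theorem.  The bad events are those of the
    fully-random tensor [G0], for which independence holds; the corrupted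
    entries of [G] are among those of [G0] for every outcome. *)
Lemma recovery_probability_ge (R : realType) (d : measure_display)
    (T : measurableType d) (P : probability T R) (n m l : nat) (p : R)
    (x : bvec n) (y : bvec m) (z : bvec l) (G : T -> btensor n m l) (K : nat) :
  0 <= p -> p < 1 / 2 -> semi_random P p x y z G ->
  (forall s, s != (x, y, z) ->
    (K <= #|corrupted (truth x y z) (truth s.1.1 s.1.2 s.2)|)%N) ->
  ((1 - 2 ^+ (n + m + l) * (2 * Num.sqrt (p * (1 - p))) ^+ K)%:E
   <= P [set w | recovers R x y z (G w)])%E.
Proof.
move=> p0 p12 [mG [G0 frG0 mono]] K_le; have [mG0 _ _ _] := frG0.
set W := truth x y z in K_le frG0 mono *; set q := 2 * Num.sqrt _.
have q0 : 0 <= q by rewrite mulr_ge0// sqrtr_ge0.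
have q1 : q <= 1 by apply/ltW/two_sqrt_lt1.
pose diff (s : bvec n * bvec m * bvec l) :=
  corrupted W (truth s.1.1 s.1.2 s.2).
(* Testing [s != (x, y, z)] inside the event makes it empty for the planted
   solution, so that the union can run over all solutions. *)
pose bad s := [set w | s != (x, y, z) /\
  (#|diff s| <= 2 * #|corrupted W (G0 w) :&: diff s|)%N].
have mbad s : measurable (bad s).
  exact: (measurable_btensor_event (fun g => s != (x, y, z) /\
    (#|diff s| <= 2 * #|corrupted W g :&: diff s|)%N)).
have Pbad s : (P (bad s) <= (q ^+ K)%:E)%E.
  have [->|sNe] := eqVneq s (x, y, z).
    have -> : bad (x, y, z) = set0.
      by apply/seteqP; split=> [w []|w []]; rewrite eqxx.
    by rewrite measure0 lee_fin exprn_ge0.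
  have -> : bad s =
      [set w | (#|diff s| <= 2 * #|corrupted W (G0 w) :&: diff s|)%N].
    by apply/seteqP; split=> [w []|w].
  apply: (le_trans (prob_corrupted_majority _ p0 p12 frG0)).
  by rewrite lee_fin; apply: ler_wiXn2l => //; exact: K_le.
pose B := \big[setU/set0]_(s <- enum {: bvec n * bvec m * bvec l}) bad s.
have mB : measurable B by exact: bigsetU_measurable.
have PB : (P B <= (2 ^+ (n + m + l) * q ^+ K)%:E)%E.
  apply: (le_trans (probability_fin_union _ mbad Pbad)).
  rewrite lee_fin big_const_seq count_predT iter_addr_0 -cardE !card_prod.
  by rewrite !card_ffun card_bool !card_ord -!expnD -(mulr_natl (q ^+ K)) natrX.
apply: (@le_trans _ _ (P (~` B))).
  by rewrite probability_setC// EFinB; apply: leeB.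
apply: le_measure; rewrite ?inE; first exact: measurableC.
  exact: (measurable_btensor_event (fun g => recovers R x y z g)).
move=> w nB; apply: recovers_of_minority => s sNe.
have lt0 : (2 * #|corrupted W (G0 w) :&: diff s| < #|diff s|)%N.
  rewrite ltnNge; apply/negP => maj; apply: nB.
  by rewrite /B -bigcup_seq; exists s; rewrite /= ?mem_enum.
apply: leq_ltn_trans lt0; rewrite leq_mul2l /=.
by apply/subset_leq_card/finset.setSI/corrupted_monotone/mono.
Qed.

Lemma ones_ratioM (R : realType) (n : nat) (x : bvec n) (r : R) :
  ones_ratio R x = r -> 0 < r ->
  [/\ (0 < n)%N, r <= 1 & #|[set i | x i]%SET|%:R = r * n%:R].
Proof.
move=> <- r0; case: n x r0 => [|n] x r0.
  by move: r0; rewrite /ones_ratio invr0 mulr0 ltxx.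
split=> //; last by rewrite /ones_ratio divfK// pnatr_eq0.
rewrite /ones_ratio ler_pdivrMr// mul1r ler_nat.
by apply: leq_trans (max_card _) _; rewrite card_ord.
Qed.

(** Each slice of the planted block is a constant fraction of the corresponding
    slice of the whole tensor.  The constant is a product of two ratios; since
    ratios are at most one, the product of all three serves for the three kinds
    of slices at once. *)
Lemma min_slice_ge (R : realType) (n m l : nat)
    (x : bvec n) (y : bvec m) (z : bvec l) (rx ry rz : R) :
  0 < rx -> 0 < ry -> 0 < rz ->
  ones_ratio R x = rx -> ones_ratio R y = ry -> ones_ratio R z = rz ->
  rx * ry * rz * (minn (n * m) (minn (n * l) (m * l)))%:R <=
  (minn (#|[set i | x i]%SET| * #|[set j | y j]%SET|)
     (minn (#|[set i | x i]%SET| * #|[set k | z k]%SET|)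
           (#|[set j | y j]%SET| * #|[set k | z k]%SET|)))%:R.
Proof.
move=> rx0 ry0 rz0 /ones_ratioM-/(_ rx0)[n0 rx1 Ex].
move=> /ones_ratioM-/(_ ry0)[m0 ry1 Ey] /ones_ratioM-/(_ rz0)[l0 rz1 Ez].
set M := minn (n * m) _.
have c0 : 0 <= rx * ry * rz by rewrite !mulr_ge0// ltW.
have leM (A k : nat) (c r : R) : (M <= k)%N -> 0 <= c -> r <= 1 ->
    rx * ry * rz = c * r -> A%:R = c * k%:R -> rx * ry * rz * M%:R <= A%:R.
  move=> Mk c_ge0 r1 E ->; apply: (@le_trans _ _ (rx * ry * rz * k%:R)).
    by rewrite ler_wpM2l// ler_nat.
  by rewrite E -mulrA ler_wpM2l// ler_piMl.
rewrite /minn; case: ifP => _; [|case: ifP => _].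
- apply: (leM _ (n * m)%N (rx * ry) rz) => //; rewrite ?geq_minl//.
  + by rewrite mulr_ge0// ltW.
  + by rewrite natrM Ex Ey natrM; ring.
- apply: (leM _ (n * l)%N (rx * rz) ry) => //.
  + by rewrite /M; lia.
  + by rewrite mulr_ge0// ltW.
  + ring.
  + by rewrite natrM Ex Ez natrM; ring.
- apply: (leM _ (m * l)%N (ry * rz) rx) => //.
  + by rewrite /M; lia.
  + by rewrite mulr_ge0// ltW.
  + ring.
  + by rewrite natrM Ey Ez natrM; ring.
Qed.

(** With [q ^ k <= 1/4] the decay [q ^ (k N) <= 4 ^ -N] beats the number [2 ^ N]
    of competitors and leaves [2 ^ -N]. *)
Lemma union_bound_le (R : realType) (q : R) (N K k : nat) :
  0 <= q -> q <= 1 -> q ^+ k <= 1 / 4 -> (k * N <= K)%N ->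
  2 ^+ N * q ^+ K <= (1 / 2) ^+ N.
Proof.
move=> q0 q1 qk kNK.
apply: (@le_trans _ _ (2 ^+ N * (1 / 4) ^+ N)).
  rewrite ler_pM2l ?exprn_gt0//; apply: (@le_trans _ _ (q ^+ (k * N))).
    exact: ler_wiXn2l.
  by rewrite exprM lerXn2r ?nnegrE ?exprn_ge0.
by rewrite -exprMn; have -> : 2 * (1 / 4) = 1 / 2 :> R by field.
Qed.

(** * Recovery with high probability *)

Unset Implicit Arguments.
Set Strict Implicit.

Theorem theorem2 (R : realType) (p rx ry rz : R)
    (n m l : nat -> nat)
    (x : forall t, bvec (n t)) (y : forall t, bvec (m t))
    (z : forall t, bvec (l t))
    (d : nat -> measure_display) (Omega : forall t, measurableType (d t))
    (P : forall t, probability (Omega t) R)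
    (G : forall t, Omega t -> btensor (n t) (m t) (l t))
    (hn : n t @[t --> \oo] --> \oo)
    (hm : m t @[t --> \oo] --> \oo)
    (hl : l t @[t --> \oo] --> \oo)
    (hrx0 : 0 < rx) (hry0 : 0 < ry) (hrz0 : 0 < rz)
    (hrx : forall t, ones_ratio R (x t) = rx)
    (hry : forall t, ones_ratio R (y t) = ry)
    (hrz : forall t, ones_ratio R (z t) = rz)
    (hlim : ((n t + m t + l t)%:R
             / (minn (n t * m t) (minn (n t * l t) (m t * l t)))%:R : R)
            @[t --> \oo] --> (0 : R))
    (hp0 : 0 <= p) (hp : p < 1 / 2)
    (hG : forall t, semi_random (P t) p (x t) (y t) (z t) (G t)) :
  P t [set w | recovers R (x t) (y t) (z t) (G t w)] @[t --> \oo]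
    --> (1%:E : \bar R).
Proof.
pose q := 2 * Num.sqrt (p * (1 - p)).
have q0 : 0 <= q by rewrite mulr_ge0// sqrtr_ge0.
have q1 : q < 1 by exact: two_sqrt_lt1.
(* The exponent is positive because the growth assumption is applied with the
   threshold [rx * ry * rz / k.+1]. *)
have [k qk] : exists k, q ^+ k.+1 <= 1 / 4.
  have : \forall k \near \oo, q ^+ k < 1 / 4.
    apply: cvgr_lt; first by apply: cvg_expr; rewrite ger0_norm.
    by lra.
  case=> k _ /(_ k.+1); rewrite /= leqnSn => /(_ isT) /ltW qk.
  by exists k.
have lower_cvg : (1 - (1 / 2) ^+ n t)%:E @[t --> \oo] --> (1%:E : \bar R).
  apply: cvg_EFin; first by near=> t.
  rewrite -[X in _ --> X](subr0 (1 : R)); apply: cvgB; first exact: cvg_cst.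
  apply: (cvg_comp n (fun i : nat => (1 / 2 : R) ^+ i) hn).
  by apply: cvg_expr; rewrite ger0_norm; lra.
apply: (squeeze_cvge _ lower_cvg (cvg_cst _)).
have c0 : 0 < rx * ry * rz by rewrite !mulr_gt0.
have ratio_small : \forall t \near \oo,
    (n t + m t + l t)%:R
      / (minn (n t * m t) (minn (n t * l t) (m t * l t)))%:R
    < rx * ry * rz / k.+1%:R.
  by apply: (cvgr_lt _ hlim); rewrite divr_gt0.
near=> t; apply/andP; split; last first.
  apply: probability_le1; have [mG _] := hG t.
  exact: (measurable_btensor_event
    (fun g => recovers R (x t) (y t) (z t) g)).
have slices := min_slice_ge hrx0 hry0 hrz0 (hrx t) (hry t) (hrz t).
have [n0 _ _] := ones_ratioM (hrx t) hrx0.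
have [m0 _ _] := ones_ratioM (hry t) hry0.
have [l0 _ _] := ones_ratioM (hrz t) hrz0.
have small : (n t + m t + l t)%:R
      / (minn (n t * m t) (minn (n t * l t) (m t * l t)))%:R
    < rx * ry * rz / k.+1%:R by near: t.
set M := minn (n t * m t) _ in small slices.
have M0 : (0 < M)%N by rewrite /M !leq_min !muln_gt0 n0 m0 l0.
set K := minn _ (minn _ _) in slices.
have kNK : (k.+1 * (n t + m t + l t) <= K)%N.
  rewrite -(ler_nat R); apply: le_trans slices; apply: ltW.
  move: small; rewrite ltr_pdivrMr ?ltr0n// mulrAC ltr_pdivlMr ?ltr0n//.
  by rewrite natrM mulrC.
apply: (le_trans _ (recovery_probability_ge (K := K) hp0 hp
  (hG t) (@card_disagreement _ _ _ _ _ _))).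
rewrite lee_fin lerD2l lerN2.
apply: (le_trans (union_bound_le q0 (ltW q1) qk kNK)).
apply: ler_wiXn2l; [lra|lra|].
by rewrite -addnA leq_addr.
Unshelve. all: by end_near.
Qed.
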